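(* Let $\mathrm{Dis}$ be a linear disparity measure with weighting function $w_{\mathrm{Dis}}$ (no distributional assumption on the features). For $t\in\mathbb R$ and measurable $\tau:\mathcal X\times\{0,1\}\to[0,1]$ let $$f_{\mathrm{Dis},t,\tau}(x,a)=I\Big(\eta_a(x)>\tfrac12+\tfrac t2w_{\mathrm{Dis}}(x,a)\Big)+\tau(x,a)\,I\Big(\eta_a(x)=\tfrac12+\tfrac t2w_{\mathrm{Dis}}(x,a)\Big),$$ $D_{\mathrm{Dis},\min}(t)=\min_\tau\mathrm{Dis}(f_{\mathrm{Dis},t,\tau})$, $D_{\mathrm{Dis},\max}(t)=\max_\tau\mathrm{Dis}(f_{\mathrm{Dis},t,\tau})$, and for $\delta\ge0$ let $$t_{\mathrm{Dis}}(\delta)=\operatorname*{argmin}_t\Big\{|t|:\inf_\tau|\mathrm{Dis}(f_{\mathrm{Dis},t,\tau})|\le\delta\Big\}=\begin{cases}\inf\{t:D_{\mathrm{Dis},\min}(t)\le\delta\},&D_{\mathrm{Dis},\min}(0)>\delta,\\ \sup\{t:D_{\mathrm{Dis},\max}(t)\ge-\delta\},&D_{\mathrm{Dis},\max}(0)<-\delta,\\ 0,&\text{otherwise.}\end{cases}$$ Then for any $\delta\ge0$ there is a measurable function $\tau_{\mathrm{Dis},\delta}:\mathcal X\times\{0,1\}\to[0,1]$ such that $f^\star_{\mathrm{Dis},\delta}=f_{\mathrm{Dis},t_{\mathrm{Dis}}(\delta),\tau_{\mathrm{Dis},\delta}}$ is a $\delta$-fair Bayes-optimal classifier, where $\tau_{\mathrm{Dis},\delta}$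 is determined to satisfy the following constraints: (1) when $D_{\mathrm{Dis},\min}(0)>\delta$: $\mathrm{Dis}(f_{\mathrm{Dis},t_{\mathrm{Dis}}(\delta),\tau_{\mathrm{Dis},\delta}})=\delta$; (2) when $D_{\mathrm{Dis},\max}(0)<-\delta$: $\mathrm{Dis}(f_{\mathrm{Dis},t_{\mathrm{Dis}}(\delta),\tau_{\mathrm{Dis},\delta}})=-\delta$; (3) when $\delta\ge\max(D_{\mathrm{Dis},\min}(0),-D_{\mathrm{Dis},\max}(0))$: $|\mathrm{Dis}(f_{\mathrm{Dis},t_{\mathrm{Dis}}(\delta),\tau_{\mathrm{Dis},\delta}})|\le\delta$.
   Context: Let $(X,A,Y)\sim\mathbb P$ be a random triple with values in $\mathcal X\times\{0,1\}\times\{0,1\}$, $p_a=\mathbb P(A=a)>0$, $\eta_a(x)=\mathbb P(Y=1\mid A=a,X=x)$. $I(\cdot)$ is the indicator function. A (randomized) classifier is a measurable $f:\mathcal X\times\{0,1\}\to[0,1]$; $\mathcal F$ is the set of all of them. Its prediction satisfies $\widehat Y_f\mid X=x,A=a\sim\mathrm{Bernoulli}(f(x,a))$, conditionally independent of $Y$ given $(X,A)$. The misclassification error is $R(f)=\mathbb P(Y\ne\widehat Y_f)$. A disparity measure $\mathrm{Dis}:\mathcal F\to[-1,1]$ is linear if there is a weighting function $w_{\mathrm{Dis}}:\mathcal X\times\{0,1\}\to\mathbb R$ (depending on $\mathbb P$) such that for all $f\in\mathcal F$, $\mathrm{Dis}(f)=\int f(x,a)\,w_{\mathrm{Dis}}(x,a)\,d\mathbb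 P_{X,A}(x,a)$. A $\delta$-fair Bayes-optimal classifier is any element of $\operatorname{argmin}_{f\in\mathcal F}\{R(f):|\mathrm{Dis}(f)|\le\delta\}$. Minima, maxima and infima over $\tau$ are over measurable $\tau:\mathcal X\times\{0,1\}\to[0,1]$.
   Formalization: The threshold t may be ±∞ (with ∞·0=0), and the argmin ranges over extended reals; if δ=0, no real t need be feasible (e.g. X uniform on (0,1], w=x, η=1), and then t_Dis(0)=±∞. Whenever a real t is feasible the statement is unchanged. *)

(* Defs.v *)
From HB Require Import structures.
From mathcomp Require Import all_boot all_order all_algebra.
From mathcomp Require Import all_classical all_reals all_analysis.

Set Implicit Arguments.
Unset Strict Implicit.
Unset Printing Implicit Defensive.

Import Order.TTheory GRing.Theory Num.Theory.
Import numFieldNormedType.Exports.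

Local Open Scope classical_set_scope.
Local Open Scope ring_scope.

(* The law of the triple (X, A, Y) is a probability P on T * bool * bool,
   so a sample z has (X, A) = z.1 and Y = z.2.  The same set [classifiers]
   serves for the randomized classifiers f and for the functions tau. *)
Section fair_classification.
Context {d : measure_display} {T : measurableType d} {R : realType}.
Implicit Types (P : probability (T * bool * bool)%type R)
  (f g tau w : T * bool -> R) (eta : bool -> T -> R)
  (Dis : (T * bool -> R) -> R).

Definition classifiers : set (T * bool -> R) :=
  [set f : T * bool -> R | measurable_fun setT f /\ forall z, 0 <= f z <= 1].

Definition law_XA P : set (T * bool) -> \bar R := pushforward P fst.

(* eta a x is a version of P(Y = 1 | A = a, X = x). *)
Definition regression_function P eta : Prop :=
  forall a : bool, measurable_fun setT (eta a) /\
    forall B : set T, measurable B ->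
      P (B `*` [set a] `*` [set true]) =
      (\int[law_XA P]_(z in B `*` [set a]) (eta a z.1)%:E)%E.

(* Law of ((X, A, Y), Yhat): given (X, A, Y) = z, Yhat is drawn from
   Bernoulli(f(X, A)); as z enters through z.1 = (X, A) only, Yhat is
   conditionally independent of Y given (X, A). *)
Definition joint_law P f : set (T * bool * bool * bool) -> \bar R :=
  kproduct_snd (fun _ : unit => P) (fun z => bernoulli_prob (f z.1)) tt.

Definition misclassification P f : \bar R :=
  joint_law P f [set zy | zy.1.2 <> zy.2].

(* The integral is extended-real valued; since it equals the finite number
   Dis f also for f = 1, integrability of w is implied. *)
Definition linear_disparity P Dis w : Prop :=
  measurable_fun setT w /\
  forall f, f \in classifiers ->
    -1 <= Dis f <= 1 /\
    (Dis f)%:E = (\int[law_XA P]_z (f z * w z)%:E)%E.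

Definition fair_bayes_optimal P Dis (delta : R) f : Prop :=
  [/\ f \in classifiers, `|Dis f| <= delta &
      forall g, g \in classifiers -> `|Dis g| <= delta ->
        (misclassification P f <= misclassification P g)%E].

(* The parameter t is an extended real because tDis below may be infinite
   (see there).  For t = +oo or -oo the products use the convention
   t * 0 = 0 of \bar R, which makes the indicators the pointwise limits of
   those at finite t wherever w <> 0, and I(eta > 1/2), I(eta = 1/2)
   where w = 0. *)
Definition boundary w (t : \bar R) (z : T * bool) : \bar R :=
  ((2^-1)%:E + t * (2^-1)%:E * (w z)%:E)%E.

Definition fDis eta w (t : \bar R) tau (z : T * bool) : R :=
  ((eta z.2 z.1)%:E > boundary w t z)%E%:R +
  tau z * ((eta z.2 z.1)%:E == boundary w t z)%:R.

Definition DisMin Dis eta w (t : \bar R) : R :=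
  inf [set Dis (fDis eta w t tau) | tau in classifiers].

Definition DisMax Dis eta w (t : \bar R) : R :=
  sup [set Dis (fDis eta w t tau) | tau in classifiers].

(* The infimum and the supremum are over real t, taken in \bar R.  The sets
   can be empty, in which case tDis is +oo, resp. -oo: for instance when
   delta = 0, w > 0 and (2 eta - 1) / w is not essentially bounded above. *)
Definition tDis Dis eta w (delta : R) : \bar R :=
  if delta < DisMin Dis eta w 0%E then
    ereal_inf [set t%:E | t in [set t : R | DisMin Dis eta w t%:E <= delta]]
  else if DisMax Dis eta w 0%E < - delta then
    ereal_sup [set t%:E | t in [set t : R | - delta <= DisMax Dis eta w t%:E]]
  else 0%E.

Definition feasible Dis eta w (delta : R) : set (\bar R) :=
  [set t | inf [set `|Dis (fDis eta w t tau)| | tau in classifiers] <= delta].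

(* As |t| is finite at every real t, this is the argmin over the feasible real
   t as soon as there is one. *)
Definition argmin_abs (S : set (\bar R)) : set (\bar R) :=
  [set t | S t /\ forall s, S s -> (`|t| <= `|s|)%E].

End fair_classification.

(* Main.v *)
Require Import Defs.
From HB Require Import structures.
From mathcomp Require Import all_boot all_order all_algebra.
From mathcomp Require Import all_classical all_reals all_analysis.
From mathcomp Require Import measurable_realfun ring lra.

Set Implicit Arguments.
Unset Strict Implicit.
Unset Printing Implicit Defensive.

Import Order.TTheory GRing.Theory Num.Theory.
Import numFieldNormedType.Exports.

Local Open Scope classical_set_scope.
Local Open Scope ring_scope.

(** Writing e for the regression function, R(f) is a constant plus the integral
of f (1 - 2 e) against the law of (X, A).  For a multiplier t the Lagrangian
R(f) + t Dis(f) has integrand f (1 - 2 e + t w), which every plug-in rule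
f_{t,tau} minimizes pointwise.  Hence such a rule is optimal as soon as t > 0
and its disparity is delta (or t < 0 and -delta, or t = 0 and at most delta in
absolute value).  Where w <> 0 the rule compares t with (2 e - 1) / w, so that
D_min and D_max are nonincreasing in t, D_min is right-continuous and D_max is
left-continuous.  Therefore D_min <= delta <= D_max at the infimum t of
{D_min <= delta}, and a convex combination of the two extreme tau attains
delta.  If this infimum is +oo, the rule is the pointwise limit of the rules at
t = n, none of which has a risk above that of a delta-fair classifier.  The case
of a disparity below -delta follows by negating w, Dis and t. *)

(** * Integrability criteria and integration against a density *)

(** In [\bar R] a difference is finite only if both terms are, so a finite integral bounds the
    positive and the negative part separately. *)
Lemma integrable_fin_num_integral (d : measure_display) (T : measurableType d)
    (R : realType) (mu : {measure set T -> \bar R}) (D : set T)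
    (f : T -> \bar R) :
  measurable D -> measurable_fun D f ->
  (\int[mu]_(x in D) f x)%E \is a fin_num -> mu.-integrable D f.
Proof.
move=> mD mf; rewrite integralE fin_numB => /andP[fp fn].
apply/integrableP; split => //.
rewrite -[fun x => `|f x|%E]/(abse \o f) fune_abse ge0_integralD //.
- by rewrite lte_add_pinfty// ltey_eq ?fp ?fn.
- exact: measurable_funepos.
- exact: measurable_funeneg.
Qed.

Lemma integrable_itv01 (d : measure_display) (T : measurableType d)
    (R : realType) (mu : {measure set T -> \bar R}) (f : T -> R) :
  (mu setT < +oo)%E -> measurable_fun setT f -> (forall x, 0 <= f x <= 1) ->
  mu.-integrable setT (EFin \o f).
Proof.
move=> muT mf f01; apply: measurable_bounded_integrable => //.
exists 1; split=> // M M1 x _ /=; have /andP[f0 f1] := f01 x.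
by rewrite ger0_norm// (le_trans f1)// ltW.
Qed.

Section density.
Context (d : measure_display) (T : measurableType d) (R : realType).
Variables (nu : {measure set T -> \bar R})
  (mu : {sigma_finite_measure set T -> \bar R}) (e : T -> R).
Hypothesis ie : mu.-integrable setT (EFin \o e).
Hypothesis nuE : forall A, measurable A ->
  nu A = (\int[mu]_(x in A) (e x)%:E)%E.

(** [nu] is finite because [e] is integrable, so it has a Radon-Nikodym derivative with respect to
    [mu]; that derivative and [e] have equal integrals over all measurable sets, hence agree almost
    everywhere. *)
Lemma integral_density (f : T -> \bar R) : nu.-integrable setT f ->
  (\int[nu]_x f x = \int[mu]_x (f x * (e x)%:E))%E.
Proof.
move=> nuf.
have nufin : fin_num_fun nu.
  move=> A mA; rewrite nuE//; apply: integrable_fin_num => //.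
  exact: integrableS ie.
pose H1 := isFinite.Build _ _ _ _ nufin.
have nusigma : sigma_finite setT nu.
  by apply: fin_num_fun_sigma_finite => //; rewrite measure0.
pose H2 := isSFinite.Build _ _ _ _ (sfinite_measure_sigma_finite nusigma).
pose H3 := isSigmaFinite.Build _ _ _ _ nusigma.
pose nu' : {finite_measure set T -> \bar R} :=
  HB.pack_for (FiniteMeasure.type T R) (Measure.sort nu) H1 H2 H3.
have me : measurable_fun setT (EFin \o e) by exact: measurable_int ie.
have numu : nu' `<< mu.
  apply/null_content_dominatesP => A mA A0; rewrite [LHS]nuE//.
  apply: null_set_integral => //; exact: measurable_funTS.
rewrite -[LHS](Radon_Nikodym_change_of_variables numu)//.
have mf := measurable_int _ nuf.
apply: ae_eq_integral => //.
- exact: emeasurable_funM.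
- exact: emeasurable_funM.
apply: ae_eqe_mul2l.
apply: integral_ae_eq => //; first exact: Radon_Nikodym_integrable.
move=> A _ mA; rewrite -Radon_Nikodym_integral//.
exact: nuE.
Qed.
End density.

(** * Weighted integrals of classifiers *)

Section weighted_integral.
Context (d : measure_display) (T : measurableType d) (R : realType).
Variable mu : probability (T * bool)%type R.
Implicit Types (f g tau h w : T * bool -> R).

Lemma classifiersP f :
  f \in classifiers <-> measurable_fun setT f /\ forall z, 0 <= f z <= 1.
Proof. by split; rewrite inE. Qed.

Lemma cst_classifier (a : R) : 0 <= a <= 1 ->
  (fun _ : T * bool => a) \in classifiers.
Proof. by move=> a01; apply/classifiersP. Qed.

Lemma integrable_classifierM f h : f \in classifiers ->
  mu.-integrable setT (EFin \o h) -> mu.-integrable setT (EFin \o (f \* h)).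
Proof.
move=> /classifiersP[mf f01] ih.
apply: le_integrable (ih) => //.
  apply/measurable_EFinP; apply: measurable_funM => //.
  by apply/measurable_EFinP; exact: measurable_int ih.
move=> z _ /=; rewrite lee_fin normrM ler_piMl//.
by have /andP[f0 f1] := f01 z; rewrite ger0_norm.
Qed.

(** Both functionals of the problem have this form: [Dis] with [h = w] and, up to a constant, the
    risk with [h = 1 - 2 eta]. *)
Definition wint h f := \int[mu]_z (f z * h z).

Lemma wint_le h f g : mu.-integrable setT (EFin \o h) ->
  f \in classifiers -> g \in classifiers ->
  (forall z, f z * h z <= g z * h z) -> wint h f <= wint h g.
Proof.
by move=> ih Cf Cg fg; apply: le_Rintegral => //; exact: integrable_classifierM.
Qed.

Lemma wint_conv h f g (a b : R) : mu.-integrable setT (EFin \o h) ->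
  f \in classifiers -> g \in classifiers ->
  wint h (fun z => a * f z + b * g z) = a * wint h f + b * wint h g.
Proof.
move=> ih Cf Cg.
have If := integrable_classifierM Cf ih.
have Ig := integrable_classifierM Cg ih.
rewrite /wint -!RintegralZl// -RintegralD//.
- by apply: eq_Rintegral => z _; rewrite mulrDl !mulrA.
- exact: (integrableZl _ a If).
- exact: (integrableZl _ b Ig).
Qed.

Lemma wintN h f : mu.-integrable setT (EFin \o h) -> f \in classifiers ->
  wint (\- h) f = - wint h f.
Proof.
move=> ih Cf; rewrite /wint -mulN1r -RintegralZl//.
  by apply: eq_Rintegral => z _; rewrite mulN1r mulrN.
exact: integrable_classifierM.
Qed.

(* Pointwise eventual equality is enough below, because for fixed z the plug-in
   rules only depend on how t compares with one number. *)
Lemma wint_limit_ge h (f_ : nat -> T * bool -> R) f (c : R) :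
  mu.-integrable setT (EFin \o h) ->
  (forall n, f_ n \in classifiers) -> f \in classifiers ->
  (forall z, \forall n \near \oo, f_ n z * h z = f z * h z) ->
  (forall n, c <= wint h (f_ n)) -> c <= wint h f.
Proof.
move=> ih Cf_ Cf fn cle.
have If := integrable_classifierM Cf ih.
have If_ n := integrable_classifierM (Cf_ n) ih.
have [] := @dominated_convergence _ _ _ mu setT measurableT
  (fun n z => (f_ n z * h z)%:E) (fun z => (f z * h z)%:E) (fun z => `|h z|%:E).
- by move=> n; exact: measurable_int (If_ n).
- exact: measurable_int If.
- apply: aeW => z _; apply: cvg_near_cst.
  by have := fn z; apply: filterS => n ->.
- exact: integrable_abse ih.
- apply: aeW => z n _; rewrite /= lee_fin normrM ler_piMl//.
  have [_ /(_ z)/andP[f0 f1]] := (classifiersP (f_ n)).1 (Cf_ n).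
  by rewrite ger0_norm.
move=> _ _ cvgI.
rewrite -lee_fin /wint fineK; last exact: integrable_fin_num.
rewrite -(cvg_lim _ cvgI)//; apply: lime_ge.
  by apply/cvg_ex; eexists; exact: cvgI.
apply: nearW => n /=; rewrite -[leRHS]fineK ?lee_fin; first exact: cle.
by apply: integrable_fin_num => //; exact: If_.
Qed.

End weighted_integral.

(** * The risk as an affine function of the classifier *)

Section risk.
Context (d : measure_display) (T : measurableType d) (R : realType).
Variables (P : probability (T * bool * bool)%type R) (eta : bool -> T -> R).
Hypothesis Heta : regression_function P eta.
Implicit Types f g tau : T * bool -> R.

Let fstX : {mfun (T * bool * bool)%type >-> (T * bool)%type} :=
  HB.pack (@fst (T * bool)%type bool)
    (isMeasurableFun.Build _ _ _ _ _ (measurable_fst : measurable_fun setT _)).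

Definition probability_XA : probability (T * bool)%type R :=
  distribution P fstX.

Let e z := eta z.2 z.1.

Lemma measurable_regression : measurable_fun setT e.
Proof.
rewrite (_ : e = fun z => if z.2 then eta true z.1 else eta false z.1);
  last first.
  by apply/funext => -[x []].
apply: measurable_fun_ifT; first exact: measurable_snd.
- by apply: measurableT_comp; [have [] := Heta true|exact: measurable_fst].
- by apply: measurableT_comp; [have [] := Heta false|exact: measurable_fst].
Qed.

Lemma regression_slice (B : set T) (a : bool) : measurable B ->
  P (B `*` [set a] `*` [set true]) =
    (\int[probability_XA]_(z in B `*` [set a]) (e z)%:E)%E.
Proof.
move=> mB; have [_ /(_ B mB) ->] := Heta a.
rewrite -[LHS]/(\int[probability_XA]_(z in B `*` [set a]) (eta a z.1)%:E)%E.
by apply: eq_integral => -[x b]; rewrite inE => -[_ /= ->].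
Qed.

(** On the slice A = a the integral of [e] is a probability, hence finite, and the two slices cover
    the space. *)
Lemma integrable_regression : probability_XA.-integrable setT (EFin \o e).
Proof.
have me : measurable_fun setT (EFin \o e).
  by apply/measurable_EFinP; exact: measurable_regression.
have slice (a : bool) :
    probability_XA.-integrable (setT `*` [set a]) (EFin \o e).
  have mS : measurable (setT `*` [set a] : set (T * bool)).
    exact: measurableX.
  apply: integrable_fin_num_integral => //; first exact: measurable_funTS.
  rewrite -regression_slice//; apply: fin_num_measure.
  exact: measurableX.
apply/integrableP; split=> //.
rewrite (_ : setT = setT `*` [set true] `|` setT `*` [set false]); last first.
  by apply/seteqP; split=> // -[x []] _; [left|right].
rewrite ge0_integral_setU//=.
- apply: lte_add_pinfty.
  + by have /integrableP[] := slice true.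
  + by have /integrableP[] := slice false.
- exact: measurableX.
- exact: measurableX.
- apply: measurable_funTS.
  exact: (measurableT_comp (@abse_measurable R setT) me).
- by apply/disj_setPS => -[x b] [[_ /= ->] [_]].
Qed.

(** The regression property is given on rectangles only; since A is binary, any measurable [C] is
    the disjoint union of two of them. *)
Lemma regression_density (C : set (T * bool)) : measurable C ->
  P (C `*` [set true]) = (\int[probability_XA]_(z in C) (e z)%:E)%E.
Proof.
move=> mC.
have mY (a : bool) : measurable (ysection C a) by exact: measurable_ysection.
have mS (a : bool) : measurable (ysection C a `*` [set a]).
  exact: measurableX.
have disj : [disjoint ysection C true `*` [set true]
    & ysection C false `*` [set false]].
  by apply/disj_setPS => -[x b] [[_ /= ->] [_]].
have CE : C =
    ysection C true `*` [set true] `|` ysection C false `*` [set false].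
  apply/seteqP; split=> [[x []] Cx|[x b]].
  - by left; split => //=; rewrite /ysection/= inE.
  - by right; split => //=; rewrite /ysection/= inE.
  - by move=> [[+ /= ->]|[+ /= ->]]; rewrite /ysection/= inE.
rewrite [in RHS]CE integral_setU_EFin//; last first.
  by apply: measurable_funTS; exact: measurable_regression.
rewrite -!regression_slice// -measureU.
- rewrite [in LHS]CE; congr (P _); apply/seteqP; split=> -[[x a] b] /=.
  + by move=> [[h|h] h']; [left|right].
  + by move=> [[h h']|[h h']]; split=> //; [left|right].
- exact: measurableX.
- exact: measurableX.
- apply/seteqP; split => // -[[x a] b] [[[_ /= ->] _] [[_ /=]]] //.
Qed.

Lemma misclassificationE f : f \in classifiers ->
  misclassification P f =
  (\int[P]_z (if z.2 then 1 - f z.1 else f z.1)%:E)%E.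
Proof.
move=> /classifiersP[mf f01].
rewrite /misclassification /joint_law /kproduct_snd /kproduct /=.
apply: eq_integral => -[z y] _ /=.
rewrite -[LHS]/(\int[bernoulli_prob (f z)]_b
  (\1_[set zy : T * bool * bool * bool | zy.1.2 <> zy.2] (z, y, b))%:E)%E.
rewrite integral_bernoulli_prob// !indicE; case: y => /=.
  by rewrite memNset ?mem_set//= mule0 mule1 add0e.
by rewrite mem_set// memNset//= mule0 mule1 adde0.
Qed.

Let mpositive : measurable (setT `*` [set true] : set (T * bool * bool)).
Proof. exact: measurableX. Qed.

Let indic_positive :
  \1_(setT `*` [set true]) = (fun z : T * bool * bool => z.2%:R : R).
Proof.
apply/funext => -[z []]; rewrite indicE; first by rewrite mem_set.
by rewrite memNset//= => -[].
Qed.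

(** Tower property for Y given (X, A): both sides integrate [f] against the law of (X, A) on the
    event Y = 1. *)
Lemma integral_positive f : f \in classifiers ->
  (\int[P]_z (f z.1 * z.2%:R)%:E)%E =
  (\int[probability_XA]_z (f z * e z)%:E)%E.
Proof.
move=> Cf; have [mf f01] := (classifiersP f).1 Cf.
have mf1 : measurable_fun setT (f \o fst : T * bool * bool -> R).
  exact: measurableT_comp.
have Pfin : (mrestr P mpositive setT < +oo)%E.
  by rewrite /mrestr setTI -ge0_fin_numE// fin_num_measure.
have [nu nuE] : exists nu : {measure set (T * bool) -> \bar R},
    nu = pushforward (mrestr P mpositive) fst :> (set (T * bool) -> \bar R).
  have mfst : measurable_fun setT (@fst (T * bool)%type bool).
    exact: measurable_fst.
  by exists (measure_function_pushforward__canonical__measure_function_Measure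
    (mrestr P mpositive) mfst).
transitivity (\int[P]_z ((f z.1)%:E * (\1_(setT `*` [set true]) z)%:E))%E.
  by apply: eq_integral => z _; rewrite indic_positive EFinM.
(* Both the restriction of P to {Y = 1}, with density 1_{Y = 1}, and its image
   under (X, A), with density e, are handled by [integral_density]. *)
rewrite -(@integral_density _ _ _ (mrestr P mpositive) P _ _ _
  (EFin \o (f \o fst))).
- transitivity (\int[nu]_z (f z)%:E)%E.
    rewrite nuE ge0_integral_pushforward//; first exact/measurable_EFinP.
    by move=> z _; rewrite lee_fin; have /andP[] := f01 z.
  rewrite (integral_density integrable_regression) //.
  + move=> C mC; rewrite -regression_density// nuE /pushforward /mrestr.
    by congr (P _); apply/seteqP; split=> [[z b] [? []]|[z b] []].
  + by apply: integrable_itv01 => //; rewrite nuE.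
- exact: integrable_indic.
- by move=> A mA; rewrite integral_indic// setIC.
- by apply: integrable_itv01 => // -[z b]; exact: f01.
Qed.

(** For y in {0, 1} the pointwise error is [y + (f - 2 f y)]; conditioning replaces y by [e] in the
    last term, and the constant is P(Y = 1). *)
Lemma misclassification_wint : exists c : R, forall f, f \in classifiers ->
  misclassification P f =
  (c + wint probability_XA (fun z => 1 - 2 * e z) f)%:E.
Proof.
have iP m (Om : measurableType m) (Q : probability Om R) (g : Om -> R) :
    measurable_fun setT g ->
    (forall z, 0 <= g z <= 1) -> Q.-integrable setT (EFin \o g).
  apply: integrable_itv01.
  by rewrite -ge0_fin_numE// fin_num_measure.
pose y (z : T * bool * bool) : R := z.2%:R.
have my : measurable_fun setT y by rewrite /y -indic_positive.
have y01 z : 0 <= y z <= 1 by rewrite /y; case: z.2 => /=; rewrite ?lexx ler01.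
have iy : P.-integrable setT (EFin \o y) by exact: iP.
have ie := integrable_regression.
exists (fine (\int[P]_z (y z)%:E)) => f Cf.
have [mf f01] := (classifiersP f).1 Cf.
have mf1 : measurable_fun setT (f \o fst : T * bool * bool -> R).
  exact: measurableT_comp.
have if1 : P.-integrable setT (EFin \o (f \o fst)).
  by apply: iP => // z; exact: f01.
have iF : probability_XA.-integrable setT (EFin \o f) by exact: iP.
have i12e : probability_XA.-integrable setT (EFin \o (fun z => 1 - 2 * e z)).
  have ic := finite_measure_integrable_cst probability_XA 1 measurableT.
  exact: (integrableB measurableT ic (integrableZl measurableT 2 ie)).
have ife := integrable_classifierM Cf ie.
have ify : P.-integrable setT (EFin \o (fun z => f z.1 * y z)).
  apply: iP => [|z]; first exact: measurable_funM.
  have /andP[a b] := f01 z.1; have /andP[a' b'] := y01 z.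
  by rewrite mulr_ge0//= mulr_ile1.
rewrite misclassificationE//.
transitivity (\int[P]_z ((y z)%:E + ((f z.1)%:E - 2%:E * (f z.1 * y z)%:E)))%E.
  apply: eq_integral => -[z b] _; rewrite -EFinM -EFinB -EFinD; congr EFin.
  by rewrite /y; case: b => /=; lra.
have i2 := integrableZl measurableT 2 ify.
rewrite integralD//; last exact: integrableB.
rewrite integralB// integralZl// integral_positive//.
rewrite [RHS]EFinD fineK; last exact: integrable_fin_num.
congr (_ + _)%E.
transitivity (\int[probability_XA]_z ((f z)%:E - 2%:E * (f z * e z)%:E))%E;
  last first.
  rewrite /wint fineK.
    by apply: eq_integral => z _; rewrite -EFinM -EFinB; congr EFin; lra.
  by apply: integrable_fin_num => //; exact: (integrable_classifierM Cf i12e).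
have i2' := integrableZl measurableT 2 ife.
rewrite integralB// integralZl//.
congr (_ - _)%E.
rewrite (@ge0_integral_distribution _ _ _ _ _ P fstX)//.
  exact/measurable_EFinP.
by move=> z; rewrite lee_fin; have /andP[] := f01 z.
Qed.

End risk.

(** * Plug-in rules and extremal tie-breaking *)

Lemma measurable_natr_bool (d : measure_display) (S : measurableType d)
    (R : realType) (b : S -> bool) :
  measurable_fun setT b -> measurable_fun setT (fun z => (b z)%:R : R).
Proof.
move=> mb; rewrite (_ : (fun z => _) = fun z => if b z then 1 else 0).
  exact: measurable_fun_ifT.
by apply/funext => z; case: (b z).
Qed.

Section plug_in.
Context (d : measure_display) (T : measurableType d) (R : realType).
Variables (mu : probability (T * bool)%type R) (eta : bool -> T -> R).

Let e z := eta z.2 z.1.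

Hypothesis ie : mu.-integrable setT (EFin \o e).
Implicit Types (f g tau w : T * bool -> R) (t s : \bar R).

Let me : measurable_fun setT e.
Proof. by apply/measurable_EFinP; exact: measurable_int ie. Qed.

Section classifier.
Variable w : T * bool -> R.
Hypothesis mw : measurable_fun setT w.

Lemma measurable_boundary t : measurable_fun setT (boundary w t).
Proof.
apply: emeasurable_funD => //; apply: emeasurable_funM => //.
exact/measurable_EFinP.
Qed.

Lemma fDis_classifier t tau : tau \in classifiers ->
  fDis eta w t tau \in classifiers.
Proof.
move=> /classifiersP[mtau tau01]; apply/classifiersP; split=> [|z].
  have mE : measurable_fun setT (EFin \o e) by exact/measurable_EFinP.
  apply: measurable_funD; first apply: measurable_natr_bool.
    exact: (measurable_fun_lte (measurable_boundary t) mE).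
  apply: measurable_funM => //; apply: measurable_natr_bool.
  exact: (measurable_fun_eqe mE (measurable_boundary t)).
rewrite /fDis; case: eqVneq => [->|_].
  by rewrite ltxx add0r mulr1.
by rewrite mulr0 addr0; case: ltP; rewrite ?lexx ?ler01.
Qed.

(** The threshold [t] at which the boundary passes through [e z], meaningful where [w z] is
    nonzero. *)
Let c z := (2 * e z - 1) / w z.

Lemma boundary_lt_pos t z : 0 < w z ->
  (boundary w t z < (e z)%:E)%E = (t < (c z)%:E)%E.
Proof.
move=> w0; rewrite /boundary; case: t => [r| |] /=.
- rewrite !lte_fin /c ltr_pdivlMr//; apply/idP/idP; lra.
- by rewrite gt0_mulye ?lte_fin// gt0_mulye ?lte_fin// addey.
- by rewrite gt0_mulNye ?lte_fin// gt0_mulNye ?lte_fin// addeNy !ltNyr.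
Qed.

Lemma boundary_lt_neg t z : w z < 0 ->
  (boundary w t z < (e z)%:E)%E = ((c z)%:E < t)%E.
Proof.
move=> w0; rewrite /boundary; case: t => [r| |] /=.
- rewrite !lte_fin /c ltr_ndivrMr//; apply/idP/idP; lra.
- by rewrite gt0_mulye ?lte_fin// lt0_mulye ?lte_fin// addeNy ltNyr ltry.
- by rewrite gt0_mulNye ?lte_fin// lt0_mulNye ?lte_fin// addey.
Qed.

Lemma boundary_eq t z : w z != 0 ->
  ((e z)%:E == boundary w t z) = (t == (c z)%:E).
Proof.
move=> w0; rewrite /boundary; case: t => [r| |] /=.
- rewrite !eqe /c; apply/eqP/eqP => [->|->]; first by field.
  by field.
- rewrite gt0_mulye ?lte_fin//; case: (ltgtP (w z) 0) w0 => // w0 _.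
    by rewrite lt0_mulye ?lte_fin// addeNy.
  by rewrite gt0_mulye ?lte_fin// addey.
- rewrite gt0_mulNye ?lte_fin//; case: (ltgtP (w z) 0) w0 => // w0 _.
    by rewrite lt0_mulNye ?lte_fin// addey.
  by rewrite gt0_mulNye ?lte_fin// addeNy.
Qed.

Lemma fDis_pos t tau z : 0 < w z -> fDis eta w t tau z =
  (t < (c z)%:E)%E%:R + tau z * (t == (c z)%:E)%:R.
Proof.
move=> w0; rewrite /fDis -[eta z.2 z.1]/(e z) boundary_lt_pos//.
by rewrite boundary_eq// gt_eqF.
Qed.

Lemma fDis_neg t tau z : w z < 0 -> fDis eta w t tau z =
  ((c z)%:E < t)%E%:R + tau z * (t == (c z)%:E)%:R.
Proof.
move=> w0; rewrite /fDis -[eta z.2 z.1]/(e z) boundary_lt_neg//.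
by rewrite boundary_eq// lt_eqF.
Qed.

(** A tie contributes [tau z * w z] to the disparity, which is largest for [tau] equal to 1 where
    [w > 0] and 0 where [w < 0]; [tau_min] makes it smallest. *)
Definition tau_max z : R := (0 < w z)%R%:R.
Definition tau_min z : R := (w z < 0)%R%:R.

Lemma tau_max_classifier : tau_max \in classifiers.
Proof.
apply/classifiersP; split=> [|z]; last first.
  by rewrite /tau_max; case: ltP; rewrite ?lexx ?ler01.
by apply: measurable_natr_bool; exact: measurable_fun_ltr.
Qed.

Lemma tau_min_classifier : tau_min \in classifiers.
Proof.
apply/classifiersP; split=> [|z]; last first.
  by rewrite /tau_min; case: ltP; rewrite ?lexx ?ler01.
by apply: measurable_natr_bool; exact: measurable_fun_ltr.
Qed.

(** Under [tau_max] a tie falls on the accepting side if [w > 0] and on the rejecting side if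
    [w < 0], so one test [t <= c z] serves both signs; it survives limits in [t] from the left. *)
Lemma fDis_maxM t z : fDis eta w t tau_max z * w z =
  if 0 < w z then (t <= (c z)%:E)%E%:R * w z
  else (~~ (t <= (c z)%:E)%E)%:R * w z.
Proof.
case: (ltgtP 0 (w z)) => [w0|w0|<-]; last by rewrite !mulr0.
- by rewrite fDis_pos// /tau_max w0 mul1r -natrD; case: (ltgtP t (c z)%:E).
- by rewrite fDis_neg// /tau_max (le_gtF (ltW w0))/= mul0r addr0 ltNge.
Qed.

(** Here the single test is the strict one, which survives limits from the right. *)
Lemma fDis_minM t z : fDis eta w t tau_min z * w z =
  if 0 < w z then (t < (c z)%:E)%E%:R * w z
  else (~~ (t < (c z)%:E)%E)%:R * w z.
Proof.
case: (ltgtP 0 (w z)) => [w0|w0|<-]; last by rewrite !mulr0.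
- by rewrite fDis_pos// /tau_min (le_gtF (ltW w0))/= mul0r addr0.
- by rewrite fDis_neg// /tau_min w0 mul1r -natrD; case: (ltgtP t (c z)%:E).
Qed.

(** The weights must sum to 1 because the strict indicator does not depend on the tie-breaking
    function. *)
Lemma fDis_conv t tau1 tau2 (a b : R) z : a + b = 1 ->
  fDis eta w t (fun z => a * tau1 z + b * tau2 z) z =
  a * fDis eta w t tau1 z + b * fDis eta w t tau2 z.
Proof. by move=> ab; have -> : b = 1 - a by [lra]; rewrite /fDis; ring. Qed.

Lemma fDis_max_ge t tau z : tau \in classifiers ->
  fDis eta w t tau z * w z <= fDis eta w t tau_max z * w z.
Proof.
move=> /classifiersP[_ /(_ z)/andP[tau0 tau1]].
rewrite -subr_ge0 -mulrBl /fDis opprD addrACA subrr add0r -mulrBl.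
rewrite mulrAC mulr_ge0// /tau_max; case: ltgtP => [w0|w0|<-].
- by rewrite mulr_ge0 ?subr_ge0// ltW.
- by rewrite sub0r mulr_le0 ?oppr_le0 ?(ltW w0).
- by rewrite mulr0.
Qed.

Lemma fDis_min_le t tau z : tau \in classifiers ->
  fDis eta w t tau_min z * w z <= fDis eta w t tau z * w z.
Proof.
move=> /classifiersP[_ /(_ z)/andP[tau0 tau1]].
rewrite -subr_ge0 -mulrBl /fDis opprD addrACA subrr add0r -mulrBl.
rewrite mulrAC mulr_ge0// /tau_min; case: ltgtP => [w0|w0|->].
- by rewrite mulr_le0 ?subr_le0// ltW.
- by rewrite subr0 mulr_ge0// ltW.
- by rewrite mulr0.
Qed.

(** Raising [t] can only turn the test [t < c z] off, which lowers the rule where [w > 0] and raises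
    it where [w < 0]. *)
Lemma fDis_min_mono s t z : (s <= t)%E ->
  fDis eta w t tau_min z * w z <= fDis eta w s tau_min z * w z.
Proof.
move=> st; rewrite !fDis_minM; case: ifPn => w0.
  rewrite ler_wpM2r ?ler_nat ?ltW//.
  by have [tc|//] := ltP t (c z)%:E; rewrite (le_lt_trans st tc).
rewrite ler_wnM2r ?ler_nat ?leNgt//.
have [tc|_] := ltP t (c z)%:E; last exact: leq_b1.
by rewrite (le_lt_trans st tc).
Qed.

End classifier.

(** * Limits in the threshold *)

(** The sequence is [t - 1/(n+1)] for finite [t] and [n] for [+oo]; either one eventually passes
    every [x < t]. *)
Lemma near_left_approx t : (-oo < t)%E -> exists r : nat -> R,
  (forall n, ((r n)%:E < t)%E) /\
  forall x : R, \forall n \near \oo, ((r n)%:E <= x%:E)%E = (t <= x%:E)%E.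
Proof.
case: t => [r| |] // _.
- exists (fun n => r - n.+1%:R^-1); split=> [n|x].
    by rewrite lte_fin ltrBlDr ltrDl invr_gt0.
  have [rx|xr] := leP r x.
    by near=> n; rewrite !lee_fin rx (le_trans _ rx)// lerBlDr lerDl invr_ge0.
  have rx0 : 0 < r - x by rewrite subr_gt0.
  near=> n; rewrite !lee_fin [RHS]leNgt xr/= leNgt; apply/negbF.
  rewrite ltrBrDl -ltrBrDr.
  by near: n; exact: (near_infty_natSinv_lt (PosNum rx0)).
- exists (fun n => n%:R); split=> [n|x]; first by rewrite ltry.
  near=> n; rewrite lee_fin leNgt; apply/negbF.
  by near: n; exact: nbhs_infty_gtr.
Unshelve. all: by end_near. Qed.

Lemma near_right_approx (r x : R) :
  \forall n \near \oo, ((r + n.+1%:R^-1)%:E < x%:E)%E = (r%:E < x%:E)%E.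
Proof.
have [rx|xr] := ltP r x.
  have rx0 : 0 < x - r by rewrite subr_gt0.
  near=> n; rewrite !lte_fin rx -ltrBrDl.
  by near: n; exact: (near_infty_natSinv_lt (PosNum rx0)).
near=> n; rewrite !lte_fin [RHS]ltNge xr/= ltNge; apply/negbF.
by rewrite (le_trans xr)// lerDl.
Unshelve. all: by end_near. Qed.

(** Where [w z] is nonzero, [n] eventually exceeds the critical ratio; where it is zero, the
    convention [+oo * 0 = 0] gives the same boundary for all thresholds. *)
Lemma fDis_pinfty_approx w tau z :
  \forall n \near \oo, fDis eta w n%:R%:E tau z = fDis eta w +oo%E tau z.
Proof.
have cn := nbhs_infty_gtr ((2 * e z - 1) / w z).
case: (ltgtP 0 (w z)) => [w0|w0|w0].
- apply: filterS cn => n cn; rewrite !fDis_pos// !ltNge leey lee_fin (ltW cn).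
  by rewrite eqe gt_eqF.
- apply: filterS cn => n cn; rewrite !fDis_neg// ltry lte_fin cn.
  by rewrite eqe gt_eqF.
- by apply: nearW => n; rewrite /fDis /boundary -w0 !mule0.
Qed.

(** * Disparity and optimality of the plug-in rules *)

Section disparity.
Variables (w : T * bool -> R) (Dis : (T * bool -> R) -> R).
Hypothesis iw : mu.-integrable setT (EFin \o w).
Hypothesis DisE : forall f, f \in classifiers -> Dis f = wint mu w f.

Let mw : measurable_fun setT w.
Proof. by apply/measurable_EFinP; exact: measurable_int iw. Qed.

Local Notation F := (fDis eta w).
Local Notation DMin := (DisMin Dis eta w).
Local Notation DMax := (DisMax Dis eta w).
Let fC := fDis_classifier mw.
Let tminC := tau_min_classifier mw.
Let tmaxC := tau_max_classifier mw.

Lemma Dis_min_le t tau : tau \in classifiers ->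
  Dis (F t (tau_min w)) <= Dis (F t tau).
Proof.
move=> Ctau; rewrite !DisE ?fC//; apply: wint_le; rewrite ?fC// => z.
exact: fDis_min_le.
Qed.

Lemma Dis_max_ge t tau : tau \in classifiers ->
  Dis (F t tau) <= Dis (F t (tau_max w)).
Proof.
move=> Ctau; rewrite !DisE ?fC//; apply: wint_le; rewrite ?fC// => z.
exact: fDis_max_ge.
Qed.

Lemma DisMinE t : DMin t = Dis (F t (tau_min w)).
Proof.
apply/eqP; rewrite eq_le; apply/andP; split.
- apply: ge_inf; last by exists (tau_min w) => //; exact/set_mem.
  exists (Dis (F t (tau_min w))) => _ [tau /mem_set Ctau <-].
  exact: Dis_min_le.
- apply: lb_le_inf.
    by exists (Dis (F t (tau_min w))), (tau_min w) => //; exact/set_mem.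
  by move=> _ [tau /mem_set Ctau <-]; exact: Dis_min_le.
Qed.

Lemma DisMaxE t : DMax t = Dis (F t (tau_max w)).
Proof.
apply/eqP; rewrite eq_le; apply/andP; split.
- apply: ge_sup.
    by exists (Dis (F t (tau_max w))), (tau_max w) => //; exact/set_mem.
  by move=> _ [tau /mem_set Ctau <-]; exact: Dis_max_ge.
- apply: ub_le_sup; last by exists (tau_max w) => //; exact/set_mem.
  exists (Dis (F t (tau_max w))) => _ [tau /mem_set Ctau <-].
  exact: Dis_max_ge.
Qed.

Lemma DisMin_le_DisMax t : DMin t <= DMax t.
Proof. by rewrite DisMinE DisMaxE Dis_min_le. Qed.

Lemma DisMin_nonincreasing s t : (s <= t)%E -> DMin t <= DMin s.
Proof.
move=> st; rewrite !DisMinE !DisE ?fC//; apply: wint_le; rewrite ?fC// => z.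
exact: fDis_min_mono.
Qed.

Lemma Dis_intermediate t (v : R) : DMin t <= v <= DMax t ->
  exists2 tau, tau \in classifiers & Dis (F t tau) = v.
Proof.
rewrite DisMinE DisMaxE => /andP[]; set m := Dis _; set M := Dis _ => mv vM.
have [mM|Mm] := ltP m M; last first.
  by exists (tau_min w) => //; apply/le_anti; rewrite mv (le_trans vM).
have Mm0 : M - m != 0 by rewrite subr_eq0 gt_eqF.
(* The weights solve [a * m + b * M = v]. *)
pose a := (M - v) / (M - m); pose b := (v - m) / (M - m).
have ab : a + b = 1 by rewrite /a /b; field.
have a0 : 0 <= a by rewrite divr_ge0 ?subr_ge0// ltW.
have b0 : 0 <= b by rewrite divr_ge0 ?subr_ge0// ltW.
pose tau z := a * tau_min w z + b * tau_max w z.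
have Ctau : tau \in classifiers.
  have [mmin min01] := (classifiersP _).1 tminC.
  have [mmax max01] := (classifiersP _).1 tmaxC.
  apply/classifiersP; split=> [|z].
    by apply: measurable_funD; apply: measurable_funM.
  have /andP[? ?] := min01 z; have /andP[? ?] := max01 z.
  apply/andP; split; first by rewrite addr_ge0// mulr_ge0.
  by rewrite -ab lerD// ler_piMr.
exists tau => //; rewrite DisE ?fC//.
rewrite (_ : F t tau =
    fun z => a * F t (tau_min w) z + b * F t (tau_max w) z); last first.
  by apply/funext => z; exact: fDis_conv.
rewrite wint_conv ?fC// -!DisE ?fC// -/m -/M /a /b; by field.
Qed.

Lemma DisMax_left_limit t (v : R) : (-oo < t)%E ->
  (forall r : R, (r%:E < t)%E -> v <= DMax r%:E) -> v <= DMax t.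
Proof.
move=> /near_left_approx[r [rt rlim]] vD; rewrite DisMaxE DisE ?fC//.
apply: (@wint_limit_ge _ _ _ _ _ (fun n => F (r n)%:E (tau_max w)));
  rewrite ?fC//.
- by move=> n; exact: fC.
- move=> z; have := rlim ((2 * e z - 1) / w z).
  by apply: filterS => n rnE; rewrite !fDis_maxM rnE.
- by move=> n; rewrite -DisE ?fC// -DisMaxE vD.
Qed.

Lemma DisMin_right_limit (r v : R) :
  (forall s : R, r < s -> DMin s%:E <= v) -> DMin r%:E <= v.
Proof.
(* [wint_limit_ge] passes lower bounds to the limit, so the weight is negated to handle an upper
   bound. *)
move=> vD; rewrite DisMinE DisE ?fC// -lerN2 -wintN ?fC//.
apply: (@wint_limit_ge _ _ _ _ _
  (fun n => F (r + n.+1%:R^-1)%:E (tau_min w))); rewrite ?fC//.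
- exact: (integrableN iw).
- by move=> n; exact: fC.
- move=> z; have := near_right_approx r ((2 * e z - 1) / w z).
  by apply: filterS => n rnE; rewrite !mulrN !fDis_minM rnE.
- move=> n; rewrite wintN ?fC// lerN2 -DisE ?fC// -DisMinE vD//.
  by rewrite ltrDl invr_gt0.
Qed.

(** At [+oo] the rule under [tau_min] rejects where [w > 0] and accepts where [w < 0]. This makes
    [DMin +oo <= delta] available when no real threshold reaches [delta]. *)
Lemma DisMin_pinfty_le0 : DMin +oo%E <= 0.
Proof.
have C0 : (fun _ : T * bool => 0 : R) \in classifiers.
  by apply: cst_classifier; rewrite lexx ler01.
rewrite DisMinE DisE ?fC// (@le_trans _ _ (wint mu w (fun=> 0)))//.
  apply: wint_le; rewrite ?fC// => z; rewrite mul0r fDis_minM.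
  case: ltP => w0; last by rewrite ltNge leey/= mul1r.
  by rewrite ltNge leey/= mul0r.
rewrite /wint; under eq_Rintegral do rewrite mul0r.
by rewrite Rintegral_cst// mul0r.
Qed.

Let h z := 1 - 2 * e z.

Let ih : mu.-integrable setT (EFin \o h).
Proof.
have ic := finite_measure_integrable_cst mu 1 measurableT.
exact: (integrableB measurableT ic (integrableZl measurableT 2 ie)).
Qed.

(* The Lagrangian with multiplier r has integrand f (1 - 2 e + r w), which the
   plug-in rule at r minimizes pointwise. *)
Lemma lagrangian_min (r : R) tau g : tau \in classifiers -> g \in classifiers ->
  wint mu h (F r%:E tau) + r * Dis (F r%:E tau) <= wint mu h g + r * Dis g.
Proof.
move=> Ctau Cg; pose k z := h z + r * w z.
have irw : mu.-integrable setT (EFin \o (fun z => r * w z)).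
  exact: (integrableZl measurableT r iw).
have ik : mu.-integrable setT (EFin \o k).
  exact: (integrableD measurableT ih irw).
have wintk f : f \in classifiers -> wint mu k f = wint mu h f + r * Dis f.
  move=> Cf; have If := integrable_classifierM Cf ih.
  have Iw := integrable_classifierM Cf iw.
  rewrite DisE// /wint -RintegralZl// -RintegralD//.
    by apply: eq_Rintegral => z _; rewrite /k; ring.
  exact: (integrableZl measurableT r Iw).
rewrite -!wintk ?fC//; apply: wint_le; rewrite ?fC// => z.
have /andP[g0 g1] := ((classifiersP g).1 Cg).2 z.
rewrite /fDis /boundary -!EFinM -EFinD lte_fin eqe -[eta z.2 z.1]/(e z).
(* Twice the gap between the boundary and [e z]: negative exactly where the rule accepts strictly,
   zero on ties. *)
have kE : k z = 2 * ((2^-1 + r * 2^-1 * w z) - e z) by rewrite /k /h; field.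
case: (ltgtP (e z) _) => ez;
  rewrite ?(mulr0, mulr1, add0r, addr0, mul0r, mul1r).
- by rewrite mulr_ge0// kE; lra.
- have k0 : k z <= 0 by rewrite kE; lra.
  nra.
- by rewrite kE -ez subrr !mulr0.
Qed.

(** For finite [t > 0], [Dis g <= delta] bounds the multiplier term of [g] by [t * delta], which is
    that of the rule; comparing Lagrangians then compares risks. *)
Lemma threshold_min (delta : R) : 0 <= delta -> delta < DMin 0%E ->
  let t := ereal_inf [set t%:E | t in [set t : R | DMin t%:E <= delta]] in
  [/\ (0 < t)%E, DMin t <= delta <= DMax t,
      forall s, DMin s <= delta -> (t <= s)%E &
      forall tau g, tau \in classifiers -> g \in classifiers ->
        Dis (F t tau) = delta -> Dis g <= delta ->
        wint mu h (F t tau) <= wint mu h g].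
Proof.
move=> delta0 deltaD t.
have below (r : R) : (r%:E < t)%E -> delta < DMin r%:E.
  move=> rt; rewrite ltNge; apply/negP => rD.
  move: rt; rewrite ltNge; apply/negP/negPn.
  by apply: ereal_inf_lbound; exists r.
have gt0 s : DMin s <= delta -> (0 < s)%E.
  move=> sD; rewrite ltNge; apply/negP => /DisMin_nonincreasing.
  by apply/negP; rewrite -ltNge (le_lt_trans sD).
have t_ge0 : (0 <= t)%E.
  by apply/ereal_infP => _ [r /gt0 /ltW r0 <-].
have t_gtNy : (-oo < t)%E by exact: lt_le_trans t_ge0.
have DMint : DMin t <= delta.
  case tE : t t_ge0 => [r| |] // _.
    apply: DisMin_right_limit => s rs; rewrite leNgt; apply/negP => sD.
    (* A value above [delta] at [s] would, by monotonicity, make [s] a lower bound of the set,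
       although [s] exceeds its infimum. *)
    have : (s%:E <= t)%E.
      apply/ereal_infP => _ [u uD <-]; rewrite leNgt; apply/negP => us.
      by move: sD; rewrite ltNge (le_trans _ uD)// DisMin_nonincreasing// ltW.
    by rewrite tE lee_fin leNgt rs.
  by rewrite (le_trans DisMin_pinfty_le0).
have t0 := gt0 _ DMint.
split => //.
- rewrite DMint/=; apply: DisMax_left_limit => // r rt.
  by rewrite (le_trans _ (DisMin_le_DisMax _))// ltW// below.
- move=> s; case: s => [r rD| |sD]; [|by rewrite leey|].
    by apply: ereal_inf_lbound; exists r.
  by have := gt0 _ sD.
move=> tau g Ctau Cg Dtau Dg.
case tE : t t0 => [r| |] //; rewrite ?lte_fin => r0.
  have := lagrangian_min r Ctau Cg; rewrite -tE Dtau.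
  nra.
(* t = +oo: pass to the limit in n in the optimality of the rule at t = n. *)
rewrite -lerN2 -!wintN ?fC//.
apply: (@wint_limit_ge _ _ _ _ _ (fun n => F n%:R%:E tau)); rewrite ?fC//.
- exact: (integrableN ih).
- by move=> n; exact: fC.
- by move=> z; apply: filterS (fDis_pinfty_approx w tau z) => n ->.
move=> n; rewrite !wintN ?fC// lerN2.
have nD : delta < Dis (F n%:R%:E tau).
  by rewrite (lt_le_trans (below n%:R _))// ?tE ?ltry// DisMinE Dis_min_le.
have := lagrangian_min n%:R Ctau Cg.
have : 0 <= n%:R * (Dis (F n%:R%:E tau) - Dis g).
  by rewrite mulr_ge0// subr_ge0 (le_trans Dg)// ltW.
lra.
Qed.

End disparity.

(** * Symmetry under negation, feasibility and the optimal threshold *)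

(** The boundary depends on the product [t * w] alone, also at infinite [t]. *)
Lemma boundaryN w t : boundary (\- w) (- t)%E = boundary w t.
Proof. by apply/funext => z; rewrite /boundary EFinN !mulNe muleN oppeK. Qed.

Lemma fDisN w t tau : fDis eta (\- w) (- t)%E tau = fDis eta w t tau.
Proof. by apply/funext => z; rewrite /fDis boundaryN. Qed.

Lemma tau_minN w : tau_min (\- w) = tau_max w.
Proof. by apply/funext => z; rewrite /tau_min /tau_max /= oppr_lt0. Qed.

Lemma tau_maxN w : tau_max (\- w) = tau_min w.
Proof. by apply/funext => z; rewrite /tau_min /tau_max /= oppr_gt0. Qed.

Section optimal_threshold.
Variables (w : T * bool -> R) (Dis : (T * bool -> R) -> R).
Hypothesis iw : mu.-integrable setT (EFin \o w).
Hypothesis DisE : forall f, f \in classifiers -> Dis f = wint mu w f.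

Local Notation F := (fDis eta w).
Local Notation DMin := (DisMin Dis eta w).
Local Notation DMax := (DisMax Dis eta w).
Local Notation DisN := (fun f => - Dis f).

Let iwN : mu.-integrable setT (EFin \o \- w).
Proof. exact: (integrableN iw). Qed.

Let DisNE f : f \in classifiers -> DisN f = wint mu (\- w) f.
Proof. by move=> Cf; rewrite wintN// DisE. Qed.

Let DisMinN t : DisMin DisN eta (\- w) (- t)%E = - DMax t.
Proof.
by rewrite (DisMinE iwN DisNE) (DisMaxE iw DisE) fDisN tau_minN.
Qed.

Let DisMaxN t : DisMax DisN eta (\- w) (- t)%E = - DMin t.
Proof.
by rewrite (DisMaxE iwN DisNE) (DisMinE iw DisE) fDisN tau_maxN.
Qed.

Let h z := 1 - 2 * e z.

(** This is [threshold_min] for [- w], [- Dis] and [- t]; negation turns the infimum into the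
    supremum and exchanges [DMin] with [- DMax]. *)
Lemma threshold_max (delta : R) : 0 <= delta -> DMax 0%E < - delta ->
  let t := ereal_sup [set t%:E | t in [set t : R | - delta <= DMax t%:E]] in
  [/\ (t < 0)%E, DMin t <= - delta <= DMax t,
      forall s, - delta <= DMax s -> (s <= t)%E &
      forall tau g, tau \in classifiers -> g \in classifiers ->
        Dis (F t tau) = - delta -> - delta <= Dis g ->
        wint mu h (F t tau) <= wint mu h g].
Proof.
move=> delta0 deltaD t.
have deltaDN : delta < DisMin DisN eta (\- w) 0%E.
  by rewrite -oppe0 DisMinN ltrNr.
have := threshold_min iwN DisNE delta0 deltaDN.
set t' := ereal_inf _; cbv zeta.
have t'E : t' = (- t)%E.
  rewrite /t' /t /ereal_inf; congr (- ereal_sup _)%E.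
  apply/seteqP; split=> [_ [_ [u /= uD <-] <-]|_ [u /= uD <-]].
    by exists (- u) => //=; rewrite lerNl -DisMinN EFinN oppeK.
  exists (- u%:E)%E; last by rewrite oppeK.
  by exists (- u) => //=; rewrite EFinN DisMinN lerNl.
rewrite t'E => -[t0 DMt tmin opt]; split.
- by rewrite -oppe_gt0.
- by move: DMt; rewrite DisMinN DisMaxN lerNl lerNr andbC.
- move=> s sD; rewrite -leeN2; apply: tmin.
  by rewrite DisMinN lerNl.
- move=> tau g Ctau Cg Dtau Dg; have := opt tau g Ctau Cg.
  rewrite fDisN Dtau opprK; apply => //.
  by rewrite lerNl.
Qed.

(** Either [DMin t] itself lies in the band from [- delta] to [delta], or [- delta] lies between the
    two extremes. *)
Lemma small_disparity (delta : R) t : 0 <= delta ->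
  DMin t <= delta -> - delta <= DMax t ->
  exists2 tau, tau \in classifiers & `|Dis (F t tau)| <= delta.
Proof.
move=> delta0 DMt DMt'.
have [mt|tm] := leP (- delta) (DMin t).
  have [|tau Ctau Dtau] := Dis_intermediate iw DisE (t := t) (v := DMin t).
    by rewrite lexx (DisMin_le_DisMax iw DisE).
  by exists tau => //; rewrite Dtau ler_norml mt.
have [|tau Ctau Dtau] := Dis_intermediate iw DisE (t := t) (v := - delta).
  by rewrite (ltW tm).
by exists tau => //; rewrite Dtau normrN ger0_norm.
Qed.

(** The disparities at [t] fill the interval from [DMin t] to [DMax t], so feasibility means that
    this interval meets the band. *)
Lemma feasibleP (delta : R) t : 0 <= delta ->
  feasible Dis eta w delta t <-> DMin t <= delta /\ - delta <= DMax t.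
Proof.
move=> delta0; rewrite /feasible /=; set S := [set _ | _ in _].
have mw : measurable_fun setT w.
  by apply/measurable_EFinP; exact: measurable_int iw.
have S0 : S !=set0.
  exists `|Dis (F t (tau_min w))|, (tau_min w) => //.
  exact/set_mem/tau_min_classifier.
have DM tau : tau \in classifiers -> DMin t <= Dis (F t tau) <= DMax t.
  move=> Ctau; rewrite (DisMinE iw DisE) (DisMaxE iw DisE).
  by rewrite (Dis_min_le iw DisE)// (Dis_max_ge iw DisE).
split=> [infS|[DMt DMt']].
  split; first apply: le_trans infS; last (rewrite lerNl; apply: le_trans infS);
    apply: lb_le_inf => // _ [tau /mem_set/DM/andP[mt tM] <-].
    by rewrite (le_trans mt)// ler_norm.
  by rewrite -normrN (le_trans _ (ler_norm _))// lerN2.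
have [tau Ctau Dtau] := small_disparity delta0 DMt DMt'.
apply: le_trans Dtau; apply: ge_inf; last by exists tau => //; exact/set_mem.
by exists 0 => _ [? _ <-].
Qed.

(** When [t] is nonzero, all feasible thresholds lie at [t] or beyond it as seen from 0, so [t] is
    the unique one of least absolute value. *)
Lemma tDis_optimal (delta : R) : 0 <= delta ->
  let t := tDis Dis eta w delta in
  argmin_abs (feasible Dis eta w delta) = [set t] /\
  exists tau, [/\ tau \in classifiers, `|Dis (F t tau)| <= delta,
    forall g, g \in classifiers -> `|Dis g| <= delta ->
      wint mu h (F t tau) <= wint mu h g,
    delta < DMin 0%E -> Dis (F t tau) = delta &
    DMax 0%E < - delta -> Dis (F t tau) = - delta].
Proof.
move=> delta0.
have argminP t : DMin t <= delta -> - delta <= DMax t ->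
    (forall s, DMin s <= delta -> - delta <= DMax s ->
      (`|t| <= `|s|)%E /\ ((`|s| <= `|t|)%E -> s = t)) ->
    argmin_abs (feasible Dis eta w delta) = [set t].
  move=> mt Mt tP; have feast : feasible Dis eta w delta t by apply/feasibleP.
  apply/seteqP; split=> [s [/feasibleP-/(_ delta0)[ms Ms] smin]|_ ->] /=.
    by apply: (tP s ms Ms).2; exact: smin.
  by split=> // s /feasibleP-/(_ delta0)[ms Ms]; exact: (tP s ms Ms).1.
have mM t := DisMin_le_DisMax iw DisE t.
rewrite /tDis; case: ifPn => [dm|]; last rewrite -leNgt => md; last first.
  case: ifPn => [Md|]; last rewrite -leNgt => dM.
- have [] := threshold_max delta0 Md.
  set t := ereal_sup _ => t0 /andP[mt Mt] tmax opt.
  split.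
    apply: argminP => //; first by rewrite (le_trans mt)// ge0_cp.
    move=> s _ /tmax st; have s0 := le_lt_trans st t0.
    rewrite (lee0_abs (ltW t0)) (lee0_abs (ltW s0)) !leeN2; split=> //.
    by move=> ts; apply/le_anti; rewrite st.
  have [|tau Ctau Dtau] := Dis_intermediate iw DisE (t := t) (v := - delta).
    by rewrite mt.
  exists tau; split=> //.
  + by rewrite Dtau normrN ger0_norm.
  + by move=> g Cg; rewrite ler_norml => /andP[Dg _]; exact: opt.
- split.
    apply: argminP => // s _ _; rewrite abse0; split=> //.
    by move=> s0; apply/eqP; rewrite -abse_eq0 eq_le s0 abse_ge0.
  have [tau Ctau Dtau] := small_disparity delta0 md dM.
  exists tau; split=> // g Cg _.
  (* With multiplier 0 the Lagrangian reduces to the risk term, which the rule at 0 minimizes over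
     all classifiers. *)
  by have := lagrangian_min iw DisE 0 Ctau Cg; rewrite !mul0r !addr0.
- have [] := threshold_min iw DisE delta0 dm.
  set t := ereal_inf _ => t0 /andP[mt Mt] tmin opt.
  split.
    apply: argminP => //; first by rewrite (le_trans _ Mt)// ge0_cp.
    move=> s /tmin st _; have s0 := lt_le_trans t0 st.
    rewrite (gee0_abs (ltW t0)) (gee0_abs (ltW s0)); split=> //.
    by move=> ts; apply/le_anti; rewrite st ts.
  have [|tau Ctau Dtau] := Dis_intermediate iw DisE (t := t) (v := delta).
    by rewrite mt.
  exists tau; split=> //.
  + by rewrite Dtau ger0_norm.
  + by move=> g Cg; rewrite ler_norml => /andP[_ Dg]; exact: opt.
  (* The two one-sided cases exclude each other because [DMin 0 <= DMax 0] and [delta >= 0]. *)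
  + by move=> Md; have := mM 0%E; lra.
Qed.

End optimal_threshold.

End plug_in.

(** * Extrema over tie-breakings and fair Bayes optimality for the given law *)

Theorem theoremB9 (d : measure_display) (T : measurableType d) (R : realType)
    (P : probability (T * bool * bool)%type R)
    (eta : bool -> T -> R)
    (Dis : (T * bool -> R) -> R) (w : T * bool -> R)
    (p_gt0 : forall a : bool, (0 < P [set z | z.1.2 = a])%E)
    (Heta : regression_function P eta)
    (HDis : linear_disparity P Dis w) :
  (forall t : \bar R,
    (exists2 tau, tau \in classifiers &
       Dis (fDis eta w t tau) = DisMin Dis eta w t) /\
    (exists2 tau, tau \in classifiers &
       Dis (fDis eta w t tau) = DisMax Dis eta w t)) /\
  (forall delta : R, 0 <= delta ->
    argmin_abs (feasible Dis eta w delta) = [set tDis Dis eta w delta] /\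
    exists tau : T * bool -> R,
      [/\ tau \in classifiers,
          fair_bayes_optimal P Dis delta
            (fDis eta w (tDis Dis eta w delta) tau),
          (delta < DisMin Dis eta w 0%E ->
             Dis (fDis eta w (tDis Dis eta w delta) tau) = delta),
          (DisMax Dis eta w 0%E < - delta ->
             Dis (fDis eta w (tDis Dis eta w delta) tau) = - delta) &
          (Num.max (DisMin Dis eta w 0%E) (- DisMax Dis eta w 0%E) <= delta ->
             `|Dis (fDis eta w (tDis Dis eta w delta) tau)| <= delta)]).
Proof.
have muE : (law_XA P : set (T * bool) -> \bar R) = probability_XA P by [].
have ie := integrable_regression Heta.
have [mw DisP] := HDis.
have C1 : (fun _ : T * bool => 1 : R) \in classifiers.
  by apply: cst_classifier; rewrite lexx ler01.
(* The constant classifier 1 has finite disparity, which is the integral of [w]. *)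
have iw : (probability_XA P).-integrable setT (EFin \o w).
  apply: integrable_fin_num_integral => //; first exact/measurable_EFinP.
  have [_] := DisP _ C1; rewrite muE => D1.
  rewrite (eq_integral (fun z => (1 * w z)%:E)) -?D1// => z _.
  by rewrite mul1r.
have DisE f : f \in classifiers -> Dis f = wint (probability_XA P) w f.
  by move=> /DisP[_]; rewrite muE /wint /Rintegral => <-.
have [c riskE] := misclassification_wint Heta.
split=> [t|delta delta0].
  split; [exists (tau_min w); first exact: tau_min_classifier|].
    by rewrite (DisMinE ie iw DisE).
  exists (tau_max w); first exact: tau_max_classifier.
  by rewrite (DisMaxE ie iw DisE).
have [argminE [tau [Ctau Dtau opt Dmin Dmax]]] :=
  tDis_optimal ie iw DisE delta0.
have Cf := fDis_classifier ie mw (tDis Dis eta w delta) Ctau.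
split; first exact: argminE.
exists tau; split; [exact: Ctau| |exact: Dmin|exact: Dmax|by move=> _].
split; [exact: Cf|exact: Dtau|move=> g Cg Dg].
by rewrite (riskE _ Cf) (riskE _ Cg) lee_fin lerD2l opt.
Qed.
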